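(* Let $p$ be a prime with $p\equiv 5\pmod 6$ and $1667\leq p\leq 2039$. Then there exists a lattice of dimension $n=2p-2$ whose center density is larger than $\frac{((p+1)/12)^{p-1}}{p^{(p-5)/6}}$.
   Context: For a lattice ${\bf L}$ of rank $r$ with shortest nonzero vector length $\lambda$ and volume $\mathrm{Vol}({\bf L})$ (square root of the Gram determinant of a basis), the center density is $(\lambda/2)^r/\mathrm{Vol}({\bf L})$. *)

(* Defs.v *)
From HB Require Import structures.
From mathcomp Require Import all_boot all_order all_algebra.
From mathcomp Require Import all_classical all_reals.

Set Implicit Arguments.
Unset Strict Implicit.
Unset Printing Implicit Defensive.

Import Order.TTheory GRing.Theory Num.Theory.
Local Open Scope classical_set_scope.
Local Open Scope ring_scope.

(* MathComp-Analysis' norm `|v| on matrices is the sup norm, hence this one. *)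
Definition euclidean_norm (R : realType) (m : nat) (v : 'rV[R]_m) : R :=
  Num.sqrt (\sum_i v 0 i ^+ 2).

(* Lattices of rank r in the Euclidean space R^m are the sets of row vectors
   having such a basis, listed as the rows of B. *)
Definition lattice_basis (R : realType) (r m : nat) (L : set 'rV[R]_m)
    (B : 'M[R]_(r, m)) : Prop :=
  row_free B /\
  L = [set v | exists x : 'rV[int]_r, v = \sum_i (x 0 i)%:~R *: row i B].

Definition is_lattice (R : realType) (r m : nat) (L : set 'rV[R]_m) : Prop :=
  exists B : 'M[R]_(r, m), lattice_basis L B.

Definition gram (R : realType) (r m : nat) (B : 'M[R]_(r, m)) : 'M[R]_r :=
  B *m B^T.

Definition is_volume (R : realType) (r m : nat) (L : set 'rV[R]_m) (V : R) :
    Prop :=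
  exists B : 'M[R]_(r, m), lattice_basis L B /\ V = Num.sqrt (\det (gram B)).

Definition is_shortest_length (R : realType) (m : nat) (L : set 'rV[R]_m)
    (lambda : R) : Prop :=
  (exists v : 'rV[R]_m, [/\ L v, v != 0 & euclidean_norm v = lambda]) /\
  (forall v : 'rV[R]_m, L v -> v != 0 -> lambda <= euclidean_norm v).

(* The volume and the shortest length of a lattice of positive rank exist and
   are unique, so this determines delta from L. *)
Definition is_center_density (R : realType) (r m : nat) (L : set 'rV[R]_m)
    (delta : R) : Prop :=
  exists lambda V : R,
    [/\ is_shortest_length L lambda, is_volume r L V
      & delta = (lambda / 2) ^+ r / V].

(* Main.v *)
(* A Minkowski-Hlawka argument with explicit constants, instead of the
   Mordell-Weil lattices whose density is to be beaten.  Write p = 6 m + 5,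
   n = 2 (p - 1), q = 101 and l = 3 m, and consider the integer lattices with
   basis [[1, M], [0, q]], of volume q^l, for M over F_q with l columns.  Each
   nonzero integer vector of squared length at most p < q^2 belongs to at most
   a fraction q^-l of them, and there are at most 3^p theta^n such vectors,
   where theta = \sum_j 3^-(j^2) <= 22/13.  Since 3^p theta^n < q^l, some M gives
   squared minimum at least p + 1.  The resulting density
   ((p + 1) / 4)^(p - 1) / q^l is large enough because 101^3 < 3^6 * 1667. *)
Require Import Defs.
From mathcomp Require Import all_boot all_order all_algebra.
From mathcomp Require Import all_classical all_reals.
From mathcomp Require Import zify ring lra.

Set Implicit Arguments.
Unset Strict Implicit.
Unset Printing Implicit Defensive.

Import Order.TTheory GRing.Theory Num.Theory.
Local Open Scope ring_scope.

(** * Counting short integer vectors *)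

Definition sqn (n : nat) (y : 'rV[int]_n) : nat := (\sum_i `|y 0%R i| ^ 2)%N.

Lemma leq_sqn (n : nat) (y : 'rV[int]_n) (i : 'I_n) : (`|y 0%R i| ^ 2 <= sqn y)%N.
Proof. by rewrite /sqn (bigD1 i) //= leq_addr. Qed.

(** The interval [-b, b] as a finite type, so that boxes of integer vectors can be counted; the size
    2 b + 1 is written [b + b.+1] to split off the negative half. *)
Definition centered (b : nat) (j : 'I_(b + b.+1)) : int := j%:Z - b%:Z.

Lemma centered_surj (b : nat) (c : int) : (`|c| <= b)%N ->
  exists j : 'I_(b + b.+1), centered j = c.
Proof.
move=> cb; have lt : (`|(c + b%:Z)%R| < b + b.+1)%N by lia.
by exists (Ordinal lt); rewrite /centered /=; lia.
Qed.

Definition centered_row (n b : nat) (f : {ffun 'I_n -> 'I_(b + b.+1)}) : 'rV[int]_n :=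
  \row_i centered (f i).

Lemma centered_row_surj (n b : nat) (y : 'rV[int]_n) :
  (sqn y < b.+1 ^ 2)%N -> exists f : {ffun 'I_n -> 'I_(b + b.+1)}, centered_row f = y.
Proof.
move=> yb; have /fin_all_exists[f fE] (i : 'I_n) :
    exists j : 'I_(b + b.+1), centered j = y 0 i.
  apply: centered_surj; have := leq_ltn_trans (leq_sqn y i) yb.
  by rewrite ltn_sqr.
exists [ffun i => f i]; apply/rowP => i.
by rewrite mxE ffunE fE.
Qed.

(* Comparison with a geometric series: [(j + 1)^2 >= 3 j + 1]. *)
Lemma sum_third_sqr (F : realFieldType) (b : nat) :
  \sum_(j < b) (3^-1 : F) ^+ (j.+1 ^ 2) <= 9 / 26.
Proof.
(* The strengthened bound is the exact partial sum of the series of 3^-(3 j + 1), which makes the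
   induction close. *)
suff: \sum_(j < b) (3^-1 : F) ^+ (j.+1 ^ 2) <= 9 / 26 * (1 - 3^-1 ^+ (3 * b)).
  move=> /le_trans; apply; have : 0 <= (3^-1 : F) ^+ (3 * b) by apply: exprn_ge0; lra.
  lra.
elim: b => [|b IHb]; first by rewrite big_ord0 muln0 expr0; lra.
have le_exp : (3^-1 : F) ^+ (b.+1 ^ 2) <= 3^-1 ^+ (3 * b).+1.
  by apply: ler_wiXn2l; [lra | lra | nia].
rewrite big_ord_recr /=.
have -> : (3 * b.+1 = 3 * b + 3)%N by lia.
rewrite exprD; move: le_exp IHb; rewrite exprS.
set x := _ ^+ (3 * b); set s := \sum_(_ < _) _; set y := _ ^+ (_ ^ 2).
have -> : (3^-1 : F) ^+ 3 = 1 / 27 by field.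
lra.
Qed.

(** The negative half, reversed, and the positive half each contribute at most 9/26, and the center
    contributes 1. *)
Lemma theta_third (F : realFieldType) (b : nat) :
  \sum_(j < b + b.+1) (3^-1 : F) ^+ (`|centered j| ^ 2) <= 22 / 13.
Proof.
rewrite big_split_ord big_ord_recl (reindex_inj rev_ord_inj).
have half (G : 'I_b -> nat) : (forall j : 'I_b, G j = j.+1) ->
    \sum_(j < b) (3^-1 : F) ^+ (G j ^ 2) <= 9 / 26.
  by move=> GE; under eq_bigr do rewrite GE; apply: sum_third_sqr.
have -> : `|centered (rshift b (ord0 : 'I_b.+1))|%N = 0%N by rewrite /centered /=; lia.
rewrite expr0.
apply: le_trans (_ : 9 / 26 + (1 + 9 / 26) <= _); last by lra.
apply: lerD; [|rewrite lerD2l]; apply: half => j.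
  by rewrite /centered /=; have := ltn_ord j; lia.
by rewrite /centered /= /bump; lia.
Qed.

(* Chernoff bound with weight [3^-|y|^2]. *)
Lemma card_short (F : realFieldType) (n b r : nat) :
  #|[set f : {ffun 'I_n -> 'I_(b + b.+1)} | (sqn (centered_row f) <= r)%N]|%:R
    <= 3 ^+ r * (22 / 13) ^+ n :> F.
Proof.
set S := [set _ | _].
pose w (f : {ffun 'I_n -> 'I_(b + b.+1)}) : F := \prod_i 3^-1 ^+ (`|centered (f i)| ^ 2).
have wE f : w f = 3^-1 ^+ sqn (centered_row f).
  rewrite /w /sqn expr_sum; apply: eq_bigr => i _.
  by rewrite mxE.
have w_ge0 f : 0 <= w f by rewrite wE exprn_ge0 // invr_ge0.
have -> : #|S|%:R = \sum_(f in S) (1 : F) by rewrite sumr_const.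
apply: (@le_trans _ _ (\sum_(f in S) 3 ^+ r * w f)).
  apply: ler_sum => f; rewrite inE => fr.
  rewrite wE exprVn -ler_pdivrMr ?invr_gt0 ?exprn_gt0 // invrK mul1r.
  by apply: ler_weXn2l => //; lra.
rewrite -mulr_sumr ler_pM2l ?exprn_gt0 //.
apply: (@le_trans _ _ (\sum_f w f)).
  by rewrite [leRHS](bigID (mem S)) /= lerDl sumr_ge0.
(* The weight is multiplicative, so its sum over the box is the n-th power of a one-variable sum. *)
rewrite /w -(bigA_distr_bigA (fun i j => (3^-1 : F) ^+ (`|centered j| ^ 2))).
rewrite prodr_const card_ord; apply: lerXn2r; rewrite ?nnegrE; last exact: theta_third.
  by apply: sumr_ge0 => j _; rewrite exprn_ge0 // invr_ge0.
lra.
Qed.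

(** * Averaging over parity matrices *)

(* Adding [e_i *m w], where [u_i != 0], to the solutions gives disjoint
   translates indexed by [w]. *)
Lemma card_solutions (F : finFieldType) (k l : nat) (u : 'rV[F]_k) (v : 'rV[F]_l) :
  u != 0 -> (#|[set M : 'M[F]_(k, l) | u *m M == v]| * #|F| ^ l <= #|F| ^ (k * l))%N.
Proof.
move=> /rV0Pn[i ui].
rewrite -[(_ ^ l)%N](_ : #|[set: 'rV[F]_l]| = _); last by rewrite finset.cardsT card_mx mul1n.
rewrite -card_mx -cardsX.
apply: (@leq_card_in _ _ (fun Mw => Mw.1 + delta_mx i 0 *m Mw.2)) => -[M w] [M' w'].
rewrite !inE /= !andbT => /eqP uM /eqP uM' eqMw.
have := congr1 (mulmx u) eqMw; rewrite !mulmxDr uM uM' !mulmxA -colE.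
move=> /addrI eqw.
have {}eqw : w = w'.
  apply/rowP => j; have /rowP/(_ j) := eqw.
  by rewrite !mxE !big_ord1 !mxE => /(mulfI ui).
by move: eqMw; rewrite eqw => /addIr ->.
Qed.

Lemma leq_card_bigcup (I T : finType) (A : {set I}) (B : I -> {set T}) :
  (#|\bigcup_(i in A) B i| <= \sum_(i in A) #|B i|)%N.
Proof.
apply: (big_ind2 (fun (C : {set T}) c => #|C| <= c)%N) => [|C c D d Cc Dd|//].
  by rewrite cards0.
by rewrite (leq_trans (leq_card_setU C D)) // leq_add.
Qed.

(** Union bound: a short vector whose left part is nonzero mod q excludes at most a fraction q^-l of
    the matrices, and there are fewer than q^l short vectors. *)
Lemma parity_matrix_exists (q k l r : nat) :
  prime q -> (r < q ^ 2)%N ->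
  (forall b, #|[set f : {ffun 'I_(k + l) -> 'I_(b + b.+1)} |
                 (sqn (centered_row f) <= r)%N]| < q ^ l)%N ->
  exists M : 'M['F_q]_(k, l), forall y : 'rV[int]_(k + l), (sqn y <= r)%N ->
    map_mx intr (lsubmx y) *m M = map_mx intr (rsubmx y) ->
    map_mx intr (lsubmx y) = 0 :> 'rV['F_q]_k.
Proof.
(* Since r < q^2, the entries of short vectors are at most q - 1 in absolute value. *)
move=> q_prime rq /(_ q.-1).
have qE := prednK (prime_gt0 q_prime).
set S := [set _ | _] => S_lt.
pose u f : 'rV['F_q]_k := map_mx intr (lsubmx (@centered_row (k + l) q.-1 f)).
pose v f : 'rV['F_q]_l := map_mx intr (rsubmx (@centered_row (k + l) q.-1 f)).
pose bad f := [set M : 'M['F_q]_(k, l) | u f *m M == v f].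
pose T := [set f in S | u f != 0].
have /fintype.subsetPn[M _ MN] : ~~ ([set: 'M['F_q]_(k, l)] \subset \bigcup_(f in T) bad f).
  apply/negP => /subset_leq_card; rewrite finset.cardsT card_mx card_Fp // => le1.
  have le2 : (q ^ (k * l) * q ^ l <= #|S| * q ^ (k * l))%N.
    apply: (@leq_trans (\sum_(f in T) (#|bad f| * q ^ l))).
      rewrite -big_distrl leq_mul2r; apply/orP; right.
      exact: leq_trans le1 (leq_card_bigcup _ _).
    apply: (@leq_trans (\sum_(f in T) q ^ (k * l))).
      apply: leq_sum => f; rewrite inE => /andP[_ uf].
      by have := card_solutions (v f) uf; rewrite card_Fp.
    rewrite sum_nat_const leq_mul2r subset_leq_card ?orbT //.
    by apply/fintype.subsetP => f; rewrite inE => /andP[].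
  move: le2; rewrite mulnC leq_mul2r expn_eq0 eqn0Ngt prime_gt0 //= => le2.
  by move: (leq_trans S_lt le2); rewrite ltnn.
exists M => y yr eqM; apply: contra_notP (negP MN) => /eqP u0.
have [f fE] : exists f : {ffun _ -> 'I_(q.-1 + q.-1.+1)}, centered_row f = y.
  by apply: centered_row_surj; rewrite qE; apply: leq_ltn_trans yr rq.
apply/finset.bigcupP; exists f; rewrite !inE /u /v fE.
  by rewrite yr.
by rewrite eqM.
Qed.

(** * The lattice of a linear code *)

(** Construction A: the rows span the integer vectors that reduce mod q to a codeword (u, u M). *)
Definition code_basis (q k l : nat) (M : 'M['F_q]_(k, l)) : 'M[int]_(k + l) :=
  block_mx 1%:M (map_mx (fun a : 'F_q => a%:Z) M) 0 (q%:Z)%:M.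

Lemma det_code_basis (q k l : nat) (M : 'M['F_q]_(k, l)) :
  \det (code_basis M) = q%:Z ^+ l.
Proof. by rewrite det_ublock det1 mul1r det_scalar. Qed.

Lemma intr_Fp_eq0_small (q : nat) (c : int) : prime q -> (`|c| < q)%N ->
  c%:~R = 0 :> 'F_q -> c = 0.
Proof.
move=> q_prime cq /eqP; rewrite -(dvdz_pcharf (pchar_Fp q_prime)).
rewrite dvdzE /= => /dvdn_leq; lia.
Qed.

(** In a short lattice vector the left part vanishes mod q by the choice of M, hence vanishes
    because its entries are smaller than q. The right part is then q w with entries smaller than q,
    so w = 0. *)
Lemma code_basis_min (q k l r : nat) (M : 'M['F_q]_(k, l)) :
  prime q -> (r < q ^ 2)%N ->
  (forall y : 'rV[int]_(k + l), (sqn y <= r)%N ->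
    map_mx intr (lsubmx y) *m M = map_mx intr (rsubmx y) ->
    map_mx intr (lsubmx y) = 0 :> 'rV['F_q]_k) ->
  forall x : 'rV[int]_(k + l), x != 0 -> (r < sqn (x *m code_basis M))%N.
Proof.
move=> q_prime rq M_good x x0; rewrite ltnNge; apply/negP => yr.
have small i : (`|(x *m code_basis M) 0%R i| < q)%N.
  rewrite -ltn_sqr; exact: leq_ltn_trans (leq_trans (leq_sqn _ i) yr) rq.
case/negP: x0; move: yr small (M_good _ yr).
rewrite -[x]hsubmxK /code_basis mul_row_block mulmx0 addr0 mulmx1.
set u := lsubmx x; set w := rsubmx x; rewrite row_mxKl row_mxKr => yr small good.
have {}good := good _.
have /good u0 : map_mx intr u *m M = map_mx intr
    (u *m map_mx (fun a : 'F_q => a%:Z) M + w *m (q%:Z)%:M).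
  rewrite map_mxD !map_mxM /= -map_mx_comp map_scalar_mx /= -pmulrn pchar_Fp_0 //.
  rewrite mul_mx_scalar scale0r addr0; congr (_ *m _).
  by apply/matrixP => i j; rewrite !mxE /= -pmulrn natr_Zp.
have {}u0 : u = 0.
  apply/rowP => i; rewrite [RHS]mxE; apply: (@intr_Fp_eq0_small q) => //.
    by have := small (lshift l i); rewrite row_mxEl.
  by have /rowP/(_ i) := u0; rewrite !mxE.
have w0 : w = 0.
  apply/rowP => i; rewrite [RHS]mxE; have := small (rshift k i).
  rewrite row_mxEr u0 mul0mx add0r mul_mx_scalar mxE => lt_q.
  have : (q * `|w 0%R i| < q * 1)%N by rewrite muln1 -{1}(absz_nat q) -abszM.
  by rewrite ltn_pmul2l ?prime_gt0 //; lia.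
by rewrite u0 w0 row_mx0.
Qed.

(** * Center density of full-rank integer lattices *)

Lemma sqr_euclidean_norm_intr (R : realType) (n : nat) (y : 'rV[int]_n) :
  euclidean_norm (map_mx intr y : 'rV[R]_n) ^+ 2 = (sqn y)%:R.
Proof.
rewrite /euclidean_norm sqr_sqrtr; last by apply: sumr_ge0 => i _; exact: sqr_ge0.
rewrite /sqn natr_sum; apply: eq_bigr => i _.
by rewrite mxE natrX natr_absz intr_norm real_normK // num_real.
Qed.

Section IntegerLattice.
Variables (R : realType) (n : nat) (B : 'M[int]_n).
Hypothesis detB : \det B != 0.

Definition integer_lattice : set 'rV[R]_n :=
  [set v | exists x : 'rV[int]_n, v = map_mx intr (x *m B)].

Lemma integer_lattice_basis :
  lattice_basis integer_lattice (map_mx intr B : 'M[R]_n).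
Proof.
split; first by rewrite row_free_unit unitmxE det_map_mx unitfE intr_eq0.
apply/seteqP; split=> v /= [x ->]; exists x; rewrite map_mxM mulmx_sum_row;
  by apply: eq_bigr => i _; rewrite mxE.
Qed.

Lemma integer_lattice_volume : is_volume n integer_lattice `|(\det B)%:~R|.
Proof.
exists (map_mx intr B); split; first exact: integer_lattice_basis.
by rewrite /gram det_mulmx det_tr det_map_mx -expr2 sqrtr_sqr.
Qed.

Lemma intr_lattice_eq0 (x : 'rV[int]_n) :
  (map_mx intr (x *m B) == 0 :> 'rV[R]_n) = (x == 0).
Proof.
have free : (map_mx intr B : 'M[R]_n) \in unitmx.
  by rewrite unitmxE det_map_mx unitfE intr_eq0.
rewrite map_mxM -(mul0mx _ (map_mx intr B)) (can_eq (mulmxK free)).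
apply/eqP/eqP => [/rowP x0|->]; last by rewrite raddf0.
by apply/rowP => i; have := x0 i; rewrite !mxE => /eqP; rewrite intr_eq0 => /eqP.
Qed.

Lemma integer_lattice_center_density (r : nat) : (0 < n)%N ->
  (forall x : 'rV[int]_n, x != 0 -> (r <= sqn (x *m B))%N) ->
  exists delta : R, is_center_density n integer_lattice delta /\
    (Num.sqrt r%:R / 2) ^+ n / `|(\det B)%:~R| <= delta.
Proof.
(* Squared lengths are natural numbers, so a least nonzero one exists and is attained. *)
move=> n_gt0 rB; pose P m := `[< exists2 x : 'rV[int]_n, x != 0 & sqn (x *m B) = m >].
have exP : exists m, P m.
  pose x : 'rV[int]_n := const_mx 1; exists (sqn (x *m B)); apply/asboolP; exists x => //.
  by apply/eqP => /rowP/(_ (Ordinal n_gt0)); rewrite !mxE.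
case: (ex_minnP exP) => m /asboolP[x x0 xm] m_min.
have normE y : euclidean_norm (map_mx intr y : 'rV[R]_n) = Num.sqrt (sqn y)%:R.
  by rewrite -sqr_euclidean_norm_intr sqrtr_sqr ger0_norm // sqrtr_ge0.
exists ((Num.sqrt m%:R / 2) ^+ n / `|(\det B)%:~R|); split; last first.
  rewrite ler_wpM2r ?invr_ge0 // lerXn2r ?nnegrE ?divr_ge0 ?sqrtr_ge0 //.
  by rewrite ler_pM2r ?invr_gt0 // ler_wsqrtr // ler_nat -xm rB.
exists (Num.sqrt m%:R), `|(\det B)%:~R|; split => //; last exact: integer_lattice_volume.
split.
  exists (map_mx intr (x *m B)); split; first by exists x.
    by rewrite intr_lattice_eq0.
  by rewrite normE xm.
move=> v [y ->]; rewrite intr_lattice_eq0 normE => y0.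
by rewrite ler_wsqrtr // ler_nat; apply: m_min; apply/asboolP; exists y.
Qed.

End IntegerLattice.

(** * Existence of a dense lattice and numerical estimates *)

Lemma dense_lattice_exists (R : realType) (q k l r : nat) :
  prime q -> (r < q ^ 2)%N -> (0 < k + l)%N ->
  3 ^+ r * (22 / 13) ^+ (k + l) < q%:R ^+ l :> R ->
  exists (L : set 'rV[R]_(k + l)) (delta : R),
    [/\ is_lattice (k + l) L, is_center_density (k + l) L delta
      & (Num.sqrt r.+1%:R / 2) ^+ (k + l) / q%:R ^+ l <= delta].
Proof.
move=> q_prime rq n_gt0 few_short.
have [b|M M_good] := @parity_matrix_exists q k l r q_prime rq.
  rewrite -(ltr_nat R) natrX; exact: le_lt_trans (card_short R (k + l) b r) few_short.
have detB : \det (code_basis M) != 0.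
  by rewrite det_code_basis expf_neq0 // -lt0n prime_gt0.
have [delta [L_delta delta_ge]] := integer_lattice_center_density R detB n_gt0
  (code_basis_min q_prime rq M_good).
exists (integer_lattice (code_basis M)), delta; split => //.
  by exists (map_mx intr (code_basis M)); exact: integer_lattice_basis.
by move: delta_ge; rewrite det_code_basis rmorphXn /= ger0_norm ?exprn_ge0.
Qed.

Lemma few_short_numeric (F : realFieldType) (m : nat) : (16 <= m)%N ->
  3 ^+ (6 * m + 5) * (22 / 13) ^+ (12 * m + 8) < 101 ^+ (3 * m) :> F.
Proof.
move=> m16.
have -> : (12 * m + 8 = 2 * (6 * m + 4))%N by lia.
have -> : (6 * m + 5 = (6 * m + 4).+1)%N by lia.
rewrite exprS exprM -mulrA -exprMn.
have base_le : 3 * (22 / 13) ^+ 2 <= 43 / 5 :> F by lra.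
apply: (@le_lt_trans _ _ (3 * (43 / 5) ^+ (6 * m + 4))).
  by rewrite ler_pM2l ?ltr0n //; apply: lerXn2r; rewrite ?nnegrE //; lra.
rewrite addnC exprD !(exprM _ _ m) mulrA.
(* The spare factor 2 in each of the m blocks yields 2^m >= 2^16, which absorbs the remaining 3
   (43/5)^4. *)
have cube_ge : 2 * (43 / 5) ^+ 6 <= 101 ^+ 3 :> F by lra.
have : (2 * (43 / 5) ^+ 6) ^+ m <= (101 ^+ 3) ^+ m :> F.
  by apply: lerXn2r; rewrite ?nnegrE //; lra.
rewrite exprMn; apply: lt_le_trans; rewrite ltr_pM2r; last first.
  by apply: exprn_gt0; lra.
apply: (@lt_le_trans _ _ (2 ^+ 16)); first by lra.
by apply: ler_weXn2l; [lra|].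
Qed.

(* (p - 5) %/ 6 is an exact division since p = 5 %[mod 6]. *)
Theorem theorem6p3 (R : realType) (p : nat) (p_prime : prime p)
    (p_mod6 : p = 5 %[mod 6]) (p_range : (1667 <= p <= 2039)%N) :
  exists (L : set 'rV[R]_(2 * p - 2)) (delta : R),
    [/\ is_lattice (2 * p - 2) L,
        is_center_density (2 * p - 2) L delta
      & (p.+1%:R / 12) ^+ (p - 1) / p%:R ^+ ((p - 5) %/ 6) < delta].
Proof.
have [m pE] : exists m, p = (6 * m + 5)%N.
  by exists (p %/ 6)%N; rewrite {1}(divn_eq p 6) p_mod6 mulnC.
have -> : (2 * p - 2 = (9 * m + 8) + 3 * m)%N by lia.
have -> : ((p - 5) %/ 6 = m)%N by rewrite pE addnK mulKn.
have -> : (p - 1 = 6 * m + 4)%N by lia.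
have [|||L [delta [L_lattice L_delta delta_ge]]] :=
  @dense_lattice_exists R 101 (9 * m + 8) (3 * m) p isT.
- by lia.
- by lia.
- have -> : (9 * m + 8 + 3 * m = 12 * m + 8)%N by lia.
  by rewrite pE; apply: few_short_numeric; lia.
exists L, delta; split => //; apply: lt_le_trans delta_ge.
have -> : (9 * m + 8 + 3 * m = 2 * (6 * m + 4))%N by lia.
rewrite [(_ / 2) ^+ _]exprM [(_ / 2) ^+ 2]expr_div_n sqr_sqrtr //.
(* Cancelling ((p + 1) / 4)^(p - 1) reduces the claim to 101^(3 m) < 3^(6 m + 4) p^m. *)
have -> : p.+1%:R / 12 = p.+1%:R / 2 ^+ 2 * 3^-1 :> R by field.
rewrite exprMn -!mulrA ltr_pM2l; last by rewrite exprn_gt0 ?divr_gt0 ?exprn_gt0 ?ltr0n.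
rewrite exprVn -invfM ltf_pV2 ?posrE ?mulr_gt0 ?exprn_gt0 //; last by rewrite ltr0n; lia.
rewrite [3 ^+ _]exprD [3 ^+ _]exprM mulrAC -exprMn.
(* Blockwise 101^3 <= 3^6 p; strictness comes from the leftover 3^4. *)
apply: (@le_lt_trans _ _ ((3 ^+ 6 * p%:R) ^+ m)).
  rewrite exprM; apply: lerXn2r; rewrite ?nnegrE ?mulr_ge0 //.
  by have : 1667 <= p%:R :> R by [rewrite ler_nat; lia]; lra.
rewrite ltr_pMr; last by rewrite exprn_gt0 // mulr_gt0 ?exprn_gt0 // ltr0n; lia.
lra.
Qed.
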